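(* Let $G$ be a finite graph with arbitrary probabilities on its edges, let $A\subset G$ be a nonempty set of vertices, and let $0,b\in G\setminus A$ be two distinct vertices. If $0$ is isolated in $G\setminus A$ (i.e. every neighbour of $0$ in $G$ belongs to $A$), then the quadruple $(G,A,0,b)$ is good.
   Context: A graph is identified with its vertex set. Each edge $e\in E(G)$ carries a number $p(e)\in[0,1]$, and $\omega\subseteq E(G)$ is a random set of edges in which every edge $e$ is included (is ''open'') with probability $p(e)$, independently; $\mathbb{P}=\mathbb{P}_G$ is the resulting probability measure. $v\leftrightarrow w$ is the event that $v$ and $w$ are connected by a path of open edges (or $v=w$). $\mathcal{C}(v)=\{w: v\leftrightarrow w\}$ is the cluster of $v$. For a set of vertices $W$, $G\setminus W$ is the graph obtained by deleting the vertices of $W$ and all edges touching them (the other edges keep their probabilities), and $\mathbb{P}_{G\setminus W}$ is percolation on it. Definition (good). Let $A\subset G$ and $0,b\in G$ be such that $0$ and $b$ are in disjoint components of $G\setminus A$. The quadruple $(G,A,0,b)$ is good if $$\mathbb{P}(0\leftrightarrow b)\ \ge\ \min_{a\in A}\mathbb{P}(a\leftrightarrow b)-\sum_{W\cap A=\emptyset}\mathbb{P}(\mathcal{C}(0)=W)\,\min_{a\in A}\mathbb{P}_{G\setminus W}(a\leftrightarrow b),$$ where the sum is over sets of vertices $W\subset G$ disjoint from $A$. (When $b\in W$ and $\mathbb{P}(\mathcal{C}(0)=W)>0$ cannot occur, because $0$ and $b$ are in disjoint components of $G\setminus A$; only terms with $\mathbb{P}(\mathcal{C}(0)=W)>0$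 contribute.) *)

(* Defs.v *)
From HB Require Import structures.
From mathcomp Require Import all_boot all_order all_algebra.
From mathcomp Require Import reals.

Set Implicit Arguments.
Unset Strict Implicit.
Unset Printing Implicit Defensive.

Import Order.TTheory GRing.Theory Num.Theory.
Local Open Scope ring_scope.

(* A finite simple graph whose vertices form a subset of a finite type; an
   edge is the set of its two endpoints. Keeping the vertex set explicit lets
   a graph and its vertex-deleted subgraphs share one ambient type. *)
Record graph (T : finType) := Graph {
  verts : {set T};
  edges : {set {set T}};
  edgesP : forall e : {set T},
    e \in edges -> (e \subset verts) && (#|e| == 2)
}.

Lemma del_edgesP (T : finType) (G : graph T) (W e : {set T}) :
  e \in [set f in edges G | [disjoint f & W]] ->
  (e \subset verts G :\: W) && (#|e| == 2).
Proof.
rewrite inE => /andP[eG eW]; have /andP[eV ->] := edgesP eG.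
by rewrite subsetD eV eW.
Qed.

(* G \ W *)
Definition del (T : finType) (G : graph T) (W : {set T}) : graph T :=
  Graph (@del_edgesP T G W).

Definition connected_by (T : finType) (w : {set {set T}}) (x y : T) : bool :=
  connect [rel u v | [set u; v] \in w] x y.

Definition cluster (T : finType) (w : {set {set T}}) (x : T) : {set T} :=
  [set y | connected_by w x y].

Definition component (T : finType) (G : graph T) (x : T) : {set T} :=
  cluster (edges G) x.

Definition isolated (T : finType) (G : graph T) (x : T) : Prop :=
  x \in verts G /\ forall y : T, [set x; y] \notin edges G.

Section Percolation.
Variables (R : realType) (T : finType).
Implicit Types (G : graph T) (p : {set T} -> R) (w : {set {set T}}).

(* Probability that the set of open edges is exactly w, for w a subset of
   edges G, when the edges are open independently. Only the values of p on
   edges G matter, so the same p serves for every subgraph of G. *)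
Definition config_prob G p w : R :=
  \prod_(e in edges G) (if e \in w then p e else 1 - p e).

Definition Pr G p (X : pred {set {set T}}) : R :=
  \sum_(w in powerset (edges G) | X w) config_prob G p w.

Definition Pr_conn G p (x y : T) : R := Pr G p (fun w => connected_by w x y).

Definition Pr_cluster G p (x : T) (W : {set T}) : R :=
  Pr G p (fun w => cluster w x == W).

(* The minimum over a in A of Pr_conn G p a b, for A nonempty: the default
   value 1 never affects it, as probabilities are at most 1. *)
Definition min_conn G p (A : {set T}) (b : T) : R :=
  \big[Num.min/1]_(a in A) Pr_conn G p a b.

(* When b is in W, Pr_conn (del G W) p a b = 0 for every a in A, as b is then
   not a vertex of del G W and differs from a. *)
Definition good G p (A : {set T}) (o b : T) : Prop :=
  [/\ A \subset verts G,
      o \in verts (del G A),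
      b \in verts (del G A),
      [disjoint component (del G A) o & component (del G A) b]
    & Pr_conn G p o b >=
      min_conn G p A b -
      \sum_(W in powerset (verts G) | [disjoint W & A])
         Pr_cluster G p o W * min_conn (del G W) p A b].

End Percolation.

(* Main.v *)
Require Import Defs.
From HB Require Import structures.
From mathcomp Require Import all_boot all_order all_algebra.
From mathcomp Require Import reals.
From mathcomp Require Import ring lra.

Set Implicit Arguments.
Unset Strict Implicit.
Unset Printing Implicit Defensive.

Import Order.TTheory GRing.Theory Num.Theory.
Local Open Scope ring_scope.

(* Let a minimise the probability of a <-> b in H = G \ o. As o is isolated in
   G \ A, only W = {o} matters in the sum, so it suffices to show, conditionally
   on the nonempty set S of vertices of A joined to o by an open edge, that
   P(a <-> b) <= P(o <-> b). In terms of percolation on H this reads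
     P(a <-> b, a <-/-> S) <= P(S <-> b, a <-/-> S).
   It holds because P(a <-> b) <= P(s <-> b) for s in S: given a <-/-> s, the event
   a <-/-> S is negatively correlated with a <-> b and positively with s <-> b.
   Both correlations (van den Berg - Haggstrom - Kahn) are instances of
     P(Z1 <-> A, Z1 <-/-> X) P(Z2 <-/-> Y)
       <= P(Z1 u Z2 <-> A, Z1 u Z2 <-/-> X n Y) P(Z1 n Z2 <-/-> X u Y),
   where Z <-> A means that every vertex of A is connected to Z; this follows by
   revealing edges one at a time, using the four functions inequality on {0,1}. *)

(** * Product Bernoulli measures on subsets of a finite type *)

Section BernoulliProduct.
Variables (R : realFieldType) (I : finType).
Implicit Types (p : I -> R) (f g : {set I} -> R) (w D : {set I}) (e : I).

Definition bern p w : R := \prod_i (if i \in w then p i else 1 - p i).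

Definition expect p f : R := \sum_w bern p w * f w.

(** Elements of [D] are made almost surely absent rather than removed from [I], so conditioning on
    them leaves the index type unchanged. *)
Definition clear p D : I -> R := fun i => if i \in D then 0 else p i.

Definition prob_weight p := forall i, 0 <= p i <= 1.

Lemma clear_weight p D : prob_weight p -> prob_weight (clear p D).
Proof. by move=> hp i; rewrite /clear; case: ifP => // _; rewrite lexx ler01. Qed.

Lemma eq_bern p q w : p =1 q -> bern p w = bern q w.
Proof. by move=> pq; apply: eq_bigr => i _; rewrite pq. Qed.

Lemma eq_expectl p q f : p =1 q -> expect p f = expect q f.
Proof. by move=> pq; apply: eq_bigr => w _; rewrite (eq_bern w pq). Qed.

Lemma bern_ge0 p w : prob_weight p -> 0 <= bern p w.
Proof.
move=> hp; apply: prodr_ge0 => i _; have /andP[p0 p1] := hp i.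
by case: ifP => // _; rewrite subr_ge0.
Qed.

Lemma bern_eq0 p w i : i \in w -> p i = 0 -> bern p w = 0.
Proof. by move=> iw pi0; rewrite /bern (bigD1 i) //= iw pi0 mul0r. Qed.

Lemma bern_clear p D w :
  bern (clear p D) w =
  if [disjoint w & D] then \prod_(i | i \notin D) (if i \in w then p i else 1 - p i)
  else 0.
Proof.
case: ifPn => [wD | /pred0Pn[i /andP[/= iw iD]]]; last first.
  by rewrite (bern_eq0 iw) // /clear iD.
rewrite /bern (bigID (mem D)) /= big1 ?mul1r.
  by apply: eq_bigr => i iD; rewrite /clear (negPf iD).
by move=> i iD; rewrite /clear iD subr0 (disjointFl wD iD).
Qed.

(** Configurations containing an element of probability 0 have weight 0, so the pointwise comparison
    may assume that no such element is present. *)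
Lemma le_expect p f g : prob_weight p ->
  (forall w, (forall i, p i = 0 -> i \notin w) -> f w <= g w) ->
  expect p f <= expect p g.
Proof.
move=> hp fg; apply: ler_sum => w _.
have [w0 | nw0] := eqVneq (bern p w) 0; first by rewrite w0 !mul0r.
apply: ler_wpM2l; first exact: bern_ge0.
apply: fg => i pi0; apply: contra_neqN nw0 => iw; exact: bern_eq0 iw pi0.
Qed.

Lemma expectB p f g : expect p (fun w => f w - g w) = expect p f - expect p g.
Proof. by rewrite -sumrB; apply: eq_bigr => w _; rewrite mulrBr. Qed.

Lemma expectMr p f c : expect p (fun w => f w * c) = expect p f * c.
Proof. by rewrite /expect mulr_suml; apply: eq_bigr => w _; rewrite mulrA. Qed.

(** The state of [e] is independent of the rest. In both cases the remainder follows [clear p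
    [set e]], and an open [e] is put back by hand. The support of [p] shrinks when [p e != 0], which
    is what the inductions below run on. *)
Lemma expect_split p e f :
  expect p f = p e * expect (clear p [set e]) (fun w => f (e |: w))
               + (1 - p e) * expect (clear p [set e]) f.
Proof.
have ez w : [disjoint w & [set e]] = (e \notin w) by rewrite disjoint_sym disjoints1.
have clearE h : expect (clear p [set e]) h =
    \sum_(w : {set I} | e \notin w)
       (\prod_(i | i != e) (if i \in w then p i else 1 - p i)) * h w.
  rewrite /expect (bigID (fun w : {set I} => e \notin w)) /= [X in _ + X]big1.
    rewrite addr0; apply: eq_bigr => w ew; rewrite bern_clear ez ew; congr (_ * _).
    by apply: eq_bigl => i; rewrite inE.
  by move=> w ew; rewrite bern_clear ez (negPf ew) mul0r.
rewrite !clearE !mulr_sumr /expect (bigID (fun w : {set I} => e \in w)) /=.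
congr (_ + _).
  rewrite (reindex_onto (fun w => e |: w) (fun w => w :\ e)) /=; last first.
    by move=> w ew; rewrite setD1K.
  apply: eq_big => [w | w /andP[_ /eqP weq]].
    rewrite setU11 /=; apply/eqP/idP => [<- | ew]; first by rewrite setD11.
    by rewrite setU1K.
  rewrite /bern (bigD1 e) //= setU11 -mulrA; congr (_ * (_ * _)).
  by apply: eq_bigr => i ie; rewrite in_setU1 (negPf ie).
by apply: eq_bigr => w ew; rewrite /bern (bigD1 e) //= (negPf ew) -mulrA.
Qed.

Lemma card_clear p e : p e != 0 ->
  (#|[set i | clear p [set e] i != 0%R]| < #|[set i | p i != 0%R]|)%N.
Proof.
move=> pe; apply: proper_card; apply/properP; split.
  by apply/subsetP => i; rewrite !inE /clear; case: ifP; rewrite ?eqxx.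
by exists e; rewrite !inE ?pe // /clear inE eqxx eqxx.
Qed.

Lemma expect1 p : expect p (fun=> 1) = 1.
Proof.
have [n] := ubnP #|[set i | p i != 0]|; elim: n p => // n IHn p lt_n.
case: (pickP [pred i | p i != 0]) => [e /= pe | p0].
  rewrite (expect_split p e) IHn; first by rewrite !mulr1 addrC subrK.
  exact: leq_trans (card_clear pe) lt_n.
rewrite /expect (bigD1 set0) //= big1 => [|w /set0Pn[i iw]].
  rewrite addr0 mulr1 /bern big1 // => i _; rewrite inE.
  by have /negbFE/eqP-> := p0 i; rewrite subr0.
by rewrite (bern_eq0 iw) ?mul0r //; have /negbFE/eqP := p0 i.
Qed.

(** Conditioning on the trace [w1] of the configuration on [D], obtained by splitting off the
    elements of [D] one at a time. *)
Lemma expect_le0_cond p D f : prob_weight p ->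
  (forall w1, w1 \subset D -> expect (clear p D) (fun w => f (w1 :|: w)) <= 0) ->
  expect p f <= 0.
Proof.
have [n] := ubnP #|D|; elim: n D p f => // n IHn D p f lt_n hp hf.
case: (set_0Vmem D) => [D0 | [e eD]].
  have := hf set0 (sub0set _); rewrite (_ : expect _ _ = expect p f) //.
  rewrite (eq_expectl (q := p)) => [|i]; last by rewrite /clear D0 inE.
  by apply: eq_bigr => w _; rewrite set0U.
have ltD : (#|D :\ e| < n)%N by move: lt_n; rewrite (cardsD1 e D) eD.
have clD : clear (clear p [set e]) (D :\ e) =1 clear p D.
  by move=> i; rewrite /clear !inE; case: eqVneq => [->|] //=; rewrite eD.
have /andP[p0 p1] := hp e.
rewrite (expect_split p e) -oppr_ge0 opprD -!mulrN addr_ge0 // mulr_ge0 ?subr_ge0 //.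
  rewrite oppr_ge0; apply: (IHn (D :\ e)) => // [|w1 w1D]; first exact: clear_weight.
  rewrite (eq_expectl _ clD) /expect; under eq_bigr do rewrite setUA.
  by apply: hf; rewrite subUset sub1set eD (subset_trans w1D) ?subsetDl.
rewrite oppr_ge0; apply: (IHn (D :\ e)) => // [|w1 w1D]; first exact: clear_weight.
by rewrite (eq_expectl _ clD) hf // (subset_trans w1D) ?subsetDl.
Qed.

End BernoulliProduct.

(** The four functions inequality on {0,1}. After expansion in [t], products with equal indices
    compare directly; only the sum of the mixed ones needs an argument. *)
Lemma four_point (R : realFieldType) (t a0 a1 b0 b1 c0 c1 d0 d1 : R) :
  0 <= t <= 1 -> 0 <= a0 -> 0 <= a1 -> 0 <= b0 -> 0 <= b1 ->
  0 <= c0 -> 0 <= c1 -> 0 <= d0 -> 0 <= d1 ->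
  a0 * b0 <= c0 * d0 -> a1 * b1 <= c1 * d1 ->
  a1 * b0 <= c1 * d0 -> a0 * b1 <= c1 * d0 ->
  (t * a1 + (1 - t) * a0) * (t * b1 + (1 - t) * b0) <=
  (t * c1 + (1 - t) * c0) * (t * d1 + (1 - t) * d0).
Proof.
move=> /andP[t0 t1] a0p a1p b0p b1p c0p c1p d0p d1p h00 h11 h10 h01.
(* With m = [c1 * d0], k = [c0 * d1] and x, y the left-hand products, x, y <= m and x y <= m k. Then
   0 <= (m - x)(m - y) yields m (x + y) <= m (m + k), and m > 0 cancels. *)
have cross : a1 * b0 + a0 * b1 <= c1 * d0 + c0 * d1.
  have [m0 | mneq0] := eqVneq (c1 * d0) 0.
    rewrite m0 in h10 h01 *; have := mulr_ge0 c0p d1p; lra.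
  have mp : 0 < c1 * d0 by rewrite lt_def mneq0 mulr_ge0.
  rewrite -(ler_pM2l mp).
  have prod : (a1 * b0) * (a0 * b1) <= (c1 * d0) * (c0 * d1).
    rewrite [leLHS](_ : _ = (a0 * b0) * (a1 * b1)); last by ring.
    rewrite [leRHS](_ : _ = (c0 * d0) * (c1 * d1)); last by ring.
    by apply: ler_pM; rewrite ?mulr_ge0.
  have : 0 <= (c1 * d0 - a1 * b0) * (c1 * d0 - a0 * b1).
    by apply: mulr_ge0; rewrite subr_ge0.
  move: (c1 * d0) (a1 * b0) (a0 * b1) (c0 * d1) prod => m x y k; lra.
have s0 : 0 <= 1 - t by rewrite subr_ge0.
rewrite [leLHS](_ : _ = t * t * (a1 * b1) + (1 - t) * (1 - t) * (a0 * b0)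
  + t * (1 - t) * (a1 * b0 + a0 * b1)); last by ring.
rewrite [leRHS](_ : _ = t * t * (c1 * d1) + (1 - t) * (1 - t) * (c0 * d0)
  + t * (1 - t) * (c1 * d0 + c0 * d1)); last by ring.
by rewrite !lerD // ler_wpM2l // mulr_ge0.
Qed.

(** * Vertices reached from a set, and the effect of opening edges *)

Section Reach.
Variable T : finType.
Implicit Types (w : {set {set T}}) (Z X C : {set T}).

Definition reach w Z : {set T} := [set y | [exists z in Z, connected_by w z y]].

Lemma reachP w Z y : reflect (exists2 z, z \in Z & connected_by w z y) (y \in reach w Z).
Proof. by rewrite inE; apply: exists_inP. Qed.

Lemma sub_reach w Z : Z \subset reach w Z.
Proof. by apply/subsetP => z zZ; apply/reachP; exists z => //; apply: connect0. Qed.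

Lemma reach_closed w Z x y : x \in reach w Z -> [set x; y] \in w -> y \in reach w Z.
Proof.
move=> /reachP[z zZ zx] xy; apply/reachP; exists z => //.
by apply: connect_trans zx (connect1 _).
Qed.

Lemma reach_min w Z C : Z \subset C ->
  (forall x y, x \in C -> [set x; y] \in w -> y \in C) -> reach w Z \subset C.
Proof.
move=> /subsetP ZC Ccl; apply/subsetP => y /reachP[z zZ /connectP[s]].
elim: s z {zZ}(ZC _ zZ) => [|x s IHs] z zC /=; first by move=> _ ->.
by move=> /andP[zx /IHs]; apply; apply: Ccl zC zx.
Qed.

Lemma reachS w w' Z Z' : w \subset w' -> Z \subset Z' -> reach w Z \subset reach w' Z'.
Proof.
move=> /subsetP ww' ZZ'; apply: reach_min; first exact: subset_trans ZZ' (sub_reach _ _).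
by move=> x y xR /ww'; apply: reach_closed.
Qed.

Lemma connected_by_sym w x y : connected_by w x y = connected_by w y x.
Proof. by apply: sym_connect_sym => u v /=; rewrite setUC. Qed.

Lemma reach_mem1 w x y : (y \in reach w [set x]) = connected_by w x y.
Proof.
apply/reachP/idP => [[z /set1P->] // | xy]; by exists x; rewrite ?set11.
Qed.

Lemma mem_reach_sym w x S : (x \in reach w S) = ~~ [disjoint reach w [set x] & S].
Proof.
apply/reachP/pred0Pn => [[s sS sx] | [s /andP[/= xs sS]]]; exists s => //=.
  by rewrite reach_mem1 connected_by_sym sx.
by rewrite connected_by_sym -reach_mem1.
Qed.

(* The edges of [w1] all leave [v], so opening them amounts to starting the
   exploration from their other endpoints as well. *)
Lemma reach_star w w1 Z v : v \in Z -> (forall e, e \in w1 -> exists y, e = [set v; y]) ->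
  reach (w1 :|: w) Z = reach w (Z :|: [set y | [set v; y] \in w1]).
Proof.
move=> vZ w1v; apply/eqP; rewrite eqEsubset; apply/andP; split.
  apply: reach_min; first exact: subset_trans (subsetUl _ _) (sub_reach _ _).
  have sub := subsetP (sub_reach w (Z :|: [set y | [set v; y] \in w1])).
  move=> x y xR /setUP[xyw1 | xyw]; last exact: reach_closed xR xyw.
  have [u uE] := w1v _ xyw1; have : y \in [set v; u] by rewrite -uE set22.
  have vuw1 : [set v; u] \in w1 by rewrite -uE.
  by case/set2P => ->; apply: sub; rewrite !inE ?vZ ?vuw1 ?orbT.
apply: reach_min => [|x y xR xyw]; last by apply: reach_closed xR _; rewrite inE xyw orbT.
rewrite subUset sub_reach; apply/subsetP => y; rewrite inE => vy.
by apply: (reach_closed (subsetP (sub_reach _ _) _ vZ)); rewrite inE vy.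
Qed.

Lemma reach_edge w Z v u : v \in Z ->
  reach ([set v; u] |: w) Z = reach w (u |: Z).
Proof.
move=> vZ; rewrite (reach_star w vZ) => [|e /set1P->]; last by exists u.
congr (reach w _); apply/setP => y; rewrite !inE.
have [-> | yu] := eqVneq y u; first by rewrite eqxx orbT.
have [-> | yv] := eqVneq y v; first by rewrite vZ.
rewrite orbC; case: eqP => // /setP/(_ y).
by rewrite !inE eqxx (negPf yu) (negPf yv).
Qed.

Lemma reach_avoid_edge w Z X x u : x \in X -> [disjoint reach w Z & u |: X] ->
  reach ([set x; u] |: w) Z = reach w Z.
Proof.
move=> xX dis; apply/eqP; rewrite eqEsubset (reachS (subsetUr [set [set x; u]] w) (subxx Z)) andbT.
apply: reach_min (sub_reach _ _) _ => y z yR /setU1P[yz | yzw]; last exact: reach_closed yR yzw.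
have : y \in [set x; u] by rewrite -yz set21.
by case/set2P => yE; move: (disjointFr dis yR); rewrite yE !inE ?eqxx ?xX ?orbT.
Qed.

(** An exploration arriving at [u] would cross the open edge to [x], so [u] becomes forbidden as
    well; one that misses both endpoints never uses the edge. *)
Lemma disjoint_reach_edge w Z X x u : x \in X ->
  [disjoint reach ([set x; u] |: w) Z & X] = [disjoint reach w Z & u |: X].
Proof.
move=> xX; apply/idP/idP => dis; last first.
  by rewrite (reach_avoid_edge xX dis) (disjointWr (subsetUr [set u] X)).
have sub := subsetP (reachS (subsetUr [set [set x; u]] w) (subxx Z)).
apply/pred0Pn => -[y /andP[/= /sub yR /setU1P[yu | yX]]]; last by rewrite (disjointFr dis yR) in yX.
suff : x \in reach ([set x; u] |: w) Z by move/(disjointFr dis); rewrite xX.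
by apply: reach_closed yR _; rewrite yu setUC setU11.
Qed.

End Reach.

(** * The correlation inequality for explorations *)

Section Exploration.
Variables (R : realFieldType) (T : finType).
Implicit Types (p : {set T} -> R) (Z A X Y : {set T}) (w : {set {set T}}).

(** The event Z <-> A, Z <-/-> X. Taking [A] to be [set0] leaves only the avoidance of [X]. *)
Definition explore_event Z A X w : bool :=
  (A \subset reach w Z) && [disjoint reach w Z & X].

Definition explore p Z A X : R := expect p (fun w => (explore_event Z A X w)%:R).

Lemma explore_ge0 p Z A X : prob_weight p -> 0 <= explore p Z A X.
Proof. by move=> hp; apply: sumr_ge0 => w _; rewrite mulr_ge0 ?bern_ge0. Qed.

Lemma le_explore p Z A X Z' A' X' : prob_weight p ->
  (forall w, (forall e, p e = 0 -> e \notin w) ->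
     explore_event Z A X w -> explore_event Z' A' X' w) ->
  explore p Z A X <= explore p Z' A' X'.
Proof.
move=> hp imp; apply: le_expect => // w pw; rewrite ler_nat.
by move: (imp w pw); case: explore_event => // ->.
Qed.

Lemma explore_le1 p Z A X : prob_weight p -> explore p Z A X <= 1.
Proof.
move=> hp; rewrite -(expect1 p); apply: le_expect => // w _; rewrite lern1; exact: leq_b1.
Qed.

Lemma exploreSr p Z A X X' : prob_weight p -> X' \subset X ->
  explore p Z A X <= explore p Z A X'.
Proof.
move=> hp XX'; apply: le_explore => // w _ /andP[AR dis].
by rewrite /explore_event AR (disjointWr XX' dis).
Qed.

Lemma exploreSl p Z Z' X : prob_weight p -> Z' \subset Z ->
  explore p Z set0 X <= explore p Z' set0 X.
Proof.
move=> hp ZZ'; apply: le_explore => // w _ /andP[_ dis].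
by rewrite /explore_event sub0set (disjointWl (reachS (subxx w) ZZ') dis).
Qed.

Lemma explore_source p Z A X v u : v \in Z ->
  explore p Z A X =
    p [set v; u] * explore (clear p [set [set v; u]]) (u |: Z) A X +
    (1 - p [set v; u]) * explore (clear p [set [set v; u]]) Z A X.
Proof.
move=> vZ; rewrite /explore (expect_split p [set v; u]); congr (_ * _ + _).
by apply: eq_bigr => w _; rewrite /explore_event reach_edge.
Qed.

Lemma explore_target p Z A X x u : x \in X ->
  explore p Z A X =
    p [set x; u] * explore (clear p [set [set x; u]]) Z A (u |: X) +
    (1 - p [set x; u]) * explore (clear p [set [set x; u]]) Z A X.
Proof.
move=> xX; rewrite /explore (expect_split p [set x; u]); congr (_ * _ + _).
apply: eq_bigr => w _; rewrite /explore_event disjoint_reach_edge //.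
congr (_ * (nat_of_bool _)%:R).
by case dis: [disjoint _ & _]; rewrite ?andbF ?andbT ?(reach_avoid_edge xX dis).
Qed.

(* Explore one edge at a time, from a vertex of [Z1 :&: Z2] or of [X :&: Y],
   simultaneously in the four factors. When no such edge is left, the second
   factor on the right is 1 and the constraint [X :&: Y] is void. *)
Lemma explore_correlation p Z1 Z2 A X Y : prob_weight p ->
  explore p Z1 A X * explore p Z2 set0 Y <=
  explore p (Z1 :|: Z2) A (X :&: Y) * explore p (Z1 :&: Z2) set0 (X :|: Y).
Proof.
have [n] := ubnP #|[set e | p e != 0]|.
elim: n p Z1 Z2 X Y => // n IHn p Z1 Z2 X Y lt_n hp.
case: (pickP [pred vu : T * T | (p [set vu.1; vu.2] != 0) && (vu.1 \in Z1 :&: Z2)])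
    => [[v u] /andP[/= pe vZ] | noZ].
  have [vZ1 vZ2] := setIP vZ.
  have hp0 := clear_weight [set [set v; u]] hp.
  have IH := IHn (clear p [set [set v; u]]) _ _ _ _
    (leq_trans (card_clear pe) lt_n) hp0.
  rewrite (explore_source _ A X u vZ1) (explore_source _ set0 Y u vZ2).
  rewrite (explore_source _ set0 (X :|: Y) u vZ).
  rewrite (@explore_source _ (Z1 :|: Z2) A (X :&: Y) v u) ?inE ?vZ1 //.
  apply: four_point; try exact: hp; try exact: explore_ge0.
  - exact: IH.
  - by rewrite setUIr setUUr; apply: IH.
  (* With the edge open in one factor only, [u] joins the union of the sources. It may also join the
     intersection; forgetting it there only raises the second factor. *)
  - rewrite setUA; apply: le_trans (IH _ _ _ _) _.
    by rewrite ler_wpM2l ?explore_ge0 // exploreSl // setSI ?subsetUr.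
  - rewrite setUCA; apply: le_trans (IH _ _ _ _) _.
    by rewrite ler_wpM2l ?explore_ge0 // exploreSl // setIS ?subsetUr.
case: (pickP [pred vu : T * T | (p [set vu.1; vu.2] != 0) && (vu.1 \in X :&: Y)])
    => [[x u] /andP[/= pe xX] | noX].
  have [xX1 xX2] := setIP xX.
  have hp0 := clear_weight [set [set x; u]] hp.
  have IH := IHn (clear p [set [set x; u]]) _ _ _ _
    (leq_trans (card_clear pe) lt_n) hp0.
  rewrite (explore_target _ Z1 A u xX1) (explore_target _ Z2 set0 u xX2).
  rewrite (explore_target _ (Z1 :|: Z2) A u xX).
  rewrite (@explore_target _ (Z1 :&: Z2) set0 (X :|: Y) x u) ?inE ?xX1 //.
  (* For targets, a mixed case adds [u] to the union [X :|: Y], which sits in the second factor: the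
     two right-hand factors exchange roles in [four_point]. *)
  rewrite [leRHS]mulrC.
  apply: four_point; try exact: hp; try exact: explore_ge0; rewrite [leRHS]mulrC.
  - exact: IH.
  - by rewrite setUIr setUUr; apply: IH.
  - rewrite setUA; apply: le_trans (IH _ _ _ _) _.
    by rewrite ler_wpM2r ?explore_ge0 // exploreSr // setSI ?subsetUr.
  - rewrite setUCA; apply: le_trans (IH _ _ _ _) _.
    by rewrite ler_wpM2r ?explore_ge0 // exploreSr // setIS ?subsetUr.
(* A source that is also a target makes the left side vanish, so both pairs may be assumed
   disjoint. *)
have explore0 (Z B U : {set T}) : ~~ [disjoint Z & U] -> explore p Z B U = 0.
  move=> /pred0Pn[z /andP[/= zZ zU]]; apply: big1 => w _; rewrite /explore_event.
  suff -> : [disjoint reach w Z & U] = false by rewrite andbF mulr0.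
  by apply/pred0Pn; exists z; rewrite /= zU (subsetP (sub_reach w Z)).
have pos Z B U := explore_ge0 Z B U hp.
case: (boolP [disjoint Z1 & X]) => [Z1X | /explore0->]; last by rewrite mul0r mulr_ge0.
case: (boolP [disjoint Z2 & Y]) => [Z2Y | /explore0->]; last by rewrite mulr0 mulr_ge0.
apply: ler_pM => //.
  apply: le_explore => // w wp /andP[AR _]; apply/andP; split.
    by apply: subset_trans AR (reachS _ _); rewrite ?subsetUl.
  rewrite -setI_eq0 -subset0; apply/subsetP => y /setIP[yR yXY].
  suff : y \in ~: (X :&: Y) by rewrite inE yXY.
  apply: subsetP yR; apply: reach_min => [|x z _ xz].
    apply/subsetP => z /setUP[]; rewrite !inE => zZ.
      by rewrite (disjointFr Z1X zZ).
    by rewrite (disjointFr Z2Y zZ) andbF.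
  rewrite inE; apply/negP => zXY; have /= := noX (z, x).
  rewrite zXY andbT => /negbFE/eqP/wp; by rewrite setUC xz.
apply: le_trans (explore_le1 _ _ _ hp) _; rewrite -(expect1 p).
apply: le_expect => // w wp; rewrite ler1n lt0b /explore_event sub0set /=.
apply: (@disjointWl _ _ (mem (Z1 :&: Z2))).
  apply: reach_min => // x y xZ xy; have /= := noZ (x, y).
  by rewrite xZ andbT => /negbFE/eqP/wp; rewrite xy.
rewrite -setI_eq0 setIUr setU_eq0 !setI_eq0.
by rewrite (disjointWl (subsetIl Z1 Z2) Z1X) (disjointWl (subsetIr Z1 Z2) Z2Y).
Qed.

End Exploration.

(** * From one neighbour of [o] to the whole set of its open neighbours *)

Section Conditioning.
Variables (R : realFieldType) (T : finType).
Implicit Types (p : {set T} -> R) (S : {set T}) (w : {set {set T}}) (a b s o : T).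

Lemma explore_swap p (Z X : {set T}) : explore p Z set0 X = explore p X set0 Z.
Proof.
apply: eq_bigr => w _; rewrite /explore_event !sub0set /=; congr (_ * (nat_of_bool _)%:R).
suff sym (U V : {set T}) : [disjoint reach w U & V] -> [disjoint reach w V & U].
  by apply/idP/idP; apply: sym.
move=> dis; apply/pred0Pn => -[u /andP[/= /reachP[v vV vu] uU]].
suff : v \in reach w U by move/(disjointFr dis); rewrite vV.
by apply/reachP; exists u => //; rewrite connected_by_sym.
Qed.

Lemma explore_event1 a b s w :
  explore_event [set a] [set b] [set s] w = connected_by w a b && ~~ connected_by w a s.
Proof. by rewrite /explore_event sub1set disjoint_sym disjoints1 !reach_mem1. Qed.

Lemma le_explore_swap p a s b S : prob_weight p -> s \in S ->
  expect p (fun w => (connected_by w a b)%:R) <=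
  expect p (fun w => (connected_by w s b)%:R) ->
  explore p [set a] [set b] S <= explore p S [set b] [set a].
Proof.
move=> hp sS ab_sb; have pos Z B U := explore_ge0 Z B U hp.
(* On a <-> s the events a <-> b and s <-> b coincide, so this part cancels from the hypothesis. *)
have swap : explore p [set a] [set b] [set s] <= explore p [set s] [set b] [set a].
  rewrite -subr_le0 -expectB; rewrite -subr_le0 -expectB in ab_sb.
  apply: le_trans ab_sb; apply: le_expect => // w _; rewrite !explore_event1.
  rewrite (connected_by_sym w s a); case as_: (connected_by w a s); rewrite ?andbT //=.
  rewrite !andbF subr0 /connected_by.
  have csym : connect_sym [rel u v | [set u; v] \in w] by exact: connected_by_sym.
  by rewrite (same_connect csym as_) subrr.
have positive := explore_correlation [set a] [set a] [set b] S [set s] hp.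
have negative := explore_correlation [set s] S [set b] [set a] [set a] hp.
have Ss : S :&: [set s] = [set s] by apply/setIidPr; rewrite sub1set.
have SUs : S :|: [set s] = S by apply/setUidPl; rewrite sub1set.
rewrite !setUid !setIid Ss SUs in positive.
rewrite !setUid !setIid (setUC [set s]) (setIC [set s]) Ss SUs in negative.
rewrite (explore_swap p S) (explore_swap p [set s]) in negative.
(* [positive], [swap] and [negative] chain up to the common factor P(a <-/-> s). If it is 0, the
   left side is 0 too, since avoiding [S] entails avoiding [s]. *)
have [z | nz] := eqVneq (explore p [set a] set0 [set s]) 0.
  apply: le_trans (pos S [set b] [set a]); rewrite -z.
  apply: le_explore => // w _ /andP[_ dis]; rewrite /explore_event sub0set.
  by rewrite (disjointWr _ dis) // sub1set.
have zp : 0 < explore p [set a] set0 [set s] by rewrite lt_def nz pos.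
rewrite -(ler_pM2r zp); apply: le_trans positive _; apply: le_trans negative.
by rewrite ler_wpM2r.
Qed.

Lemma le_connect_star p w1 a s b o : prob_weight p ->
  (forall e, e \in w1 -> exists y, e = [set o; y]) -> [set o; s] \in w1 ->
  expect p (fun w => (connected_by w a b)%:R) <=
  expect p (fun w => (connected_by w s b)%:R) ->
  expect p (fun w => (connected_by (w1 :|: w) a b)%:R) <=
  expect p (fun w => (connected_by (w1 :|: w) o b)%:R).
Proof.
move=> hp w1o os ab_sb; set S := [set o] :|: [set y | [set o; y] \in w1].
have sS : s \in S by rewrite !inE os orbT.
rewrite -subr_le0 -expectB; have := le_explore_swap hp sS ab_sb.
rewrite -subr_le0 -expectB; apply: le_trans; apply: le_expect => // w _.
rewrite -!reach_mem1 (reach_star w (set11 o) w1o) -/S /explore_event !sub1set.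
rewrite [[disjoint reach w S & _]]disjoint_sym disjoints1 (mem_reach_sym w a) negbK.
(* If [a] meets [S], its cluster lies in that of [o]. If not, the edges of [w1] are out of its reach
   and its cluster is already determined by [w]. *)
case: (boolP [disjoint _ & _]) => [dis | ndis]; rewrite ?andbT ?andbF; last first.
  rewrite subrr subr_le0 ler_nat.
  suff sub : reach (w1 :|: w) [set a] \subset reach w S.
    by case: (boolP (b \in _)) => // /(subsetP sub) ->.
  rewrite -mem_reach_sym in ndis; rewrite -(reach_star w (set11 o) w1o) in ndis *.
  by apply: reach_min => [|x y]; [rewrite sub1set | apply: reach_closed].
rewrite lerB // ler_nat.
suff sub : reach (w1 :|: w) [set a] \subset reach w [set a].
  by case: (boolP (b \in _)) => // /(subsetP sub) ->.
apply: reach_min (sub_reach _ _) _ => x y xR /setUP[xy | xy]; last exact: reach_closed xR xy.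
have [u uE] := w1o _ xy; have : x \in [set o; u] by rewrite -uE set21.
by case/set2P => xE; move: (disjointFr dis xR); rewrite !inE xE ?eqxx // -uE xy orbT.
Qed.

End Conditioning.

(** * Percolation on a graph as a product measure, and the theorem *)

Section Percolation.
Variables (R : realType) (T : finType).
Implicit Types (G : graph T) (p : {set T} -> R).

(** Extension by 0 puts percolation on [G] and on all its subgraphs on one configuration space. *)
Definition weight G p : {set T} -> R := fun e => if e \in edges G then p e else 0.

Lemma Pr_expect G p (X : pred {set {set T}}) :
  Pr G p X = expect (weight G p) (fun w => (X w)%:R).
Proof.
rewrite /Pr /expect big_mkcond /= [RHS](bigID (mem (powerset (edges G)))) /=.
rewrite [X in _ + X]big1 ?addr0 => [|w]; last first.
  rewrite inE => /subsetPn[e ew eG].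
  by rewrite (bern_eq0 ew) ?mul0r // /weight (negPf eG).
rewrite [RHS]big_mkcond; apply: eq_bigr => w _.
case: (boolP (w \in _)) => //=; rewrite inE => /subsetP wG.
case: (X w); rewrite ?mulr0 ?mulr1 //.
rewrite /bern (bigID (mem (edges G))) /= [X in _ * X]big1 ?mulr1 => [|e eG].
  by apply: eq_bigr => e eG; rewrite /weight eG.
by rewrite /weight (negPf eG) subr0; case: ifP => // /wG; rewrite (negPf eG).
Qed.

Definition edge_probs G p := forall e, e \in edges G -> 0 <= p e <= 1.

Lemma weight_prob G p : edge_probs G p -> prob_weight (weight G p).
Proof.
move=> hp e; rewrite /weight; case: ifP => [/hp // | _]; by rewrite lexx ler01.
Qed.

Lemma del_edge_probs G p W : edge_probs G p -> edge_probs (del G W) p.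
Proof. by move=> hp e; rewrite inE => /andP[/hp]. Qed.

Lemma Pr_ge0 G p X : edge_probs G p -> 0 <= Pr G p X.
Proof.
move=> hp; rewrite Pr_expect; apply: sumr_ge0 => w _.
by rewrite mulr_ge0 // bern_ge0 //; apply: weight_prob.
Qed.

Lemma Pr_le1 G p X : edge_probs G p -> Pr G p X <= 1.
Proof.
move=> /weight_prob hp; rewrite Pr_expect -[leRHS](expect1 (weight G p)).
by apply: le_expect => // w _; rewrite lern1 leq_b1.
Qed.

Lemma min_conn_ge0 G p A b : edge_probs G p -> 0 <= min_conn G p A b.
Proof. by move=> hp; apply: le_bigmin => // a _; apply: Pr_ge0. Qed.

End Percolation.

Theorem theorem4 (R : realType) (T : finType) (G : graph T)
    (p : {set T} -> R)
    (hp : forall e : {set T}, e \in edges G -> 0 <= p e <= 1)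
    (A : {set T}) (hA : A \subset verts G) (hA0 : A != set0)
    (o b : T) (ho : o \in verts G :\: A) (hb : b \in verts G :\: A)
    (hob : o != b)
    (hiso : isolated (del G A) o) :
  good G p A o b.
Proof.
have [_ iso] := hiso; have /setDP[oG oA] := ho.
split => //.
  have from_o y : connected_by (edges (del G A)) o y -> y = o.
    by case/connectP => -[|x s] /=; [move=> _ -> | rewrite (negPf (iso x))].
  apply/pred0Pn => -[y /andP[/=]]; rewrite !inE => /from_o->.
  by rewrite connected_by_sym => /from_o/esym/eqP; rewrite (negPf hob).
set H := del G [set o]; have hpH : edge_probs H p by exact: del_edge_probs.
have /set0Pn[a0 a0A] := hA0.
(* Minimality is required in [H] only: in [G], any vertex of [A] bounds [min_conn] from above. *)
case: (arg_minP (fun a => Pr_conn H p a b) a0A) => a aA a_min.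
have minH : Pr_conn H p a b <= min_conn H p A b.
  by apply: le_bigmin => //; apply: Pr_le1.
have minG : min_conn G p A b <= Pr_conn G p a b by exact: bigmin_le_cond.
have sum_ge : Pr_cluster G p o [set o] * Pr_conn H p a b <=
    \sum_(W in powerset (verts G) | [disjoint W & A])
       Pr_cluster G p o W * min_conn (del G W) p A b.
  rewrite (bigD1 [set o]) /=; last by rewrite inE sub1set oG disjoints1.
  rewrite -[leLHS]addr0 lerD ?ler_wpM2l ?Pr_ge0 // sumr_ge0 // => W _.
  by rewrite mulr_ge0 ?Pr_ge0 // min_conn_ge0 //; apply: del_edge_probs.
suff : Pr_conn G p a b - Pr_conn G p o b - Pr_cluster G p o [set o] * Pr_conn H p a b <= 0.
  by move: minG sum_ge => /=; lra.
have hpG := weight_prob hp; have hpH' := weight_prob hpH.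
rewrite {1 2}/Pr_conn /Pr_cluster !(Pr_expect G) -expectMr -!expectB.
(* Given the set [w1] of open edges at [o], what remains is percolation on [H]. *)
apply: (expect_le0_cond (D := [set e in edges G | o \in e])) => // w1 w1D.
have clearE : clear (weight G p) [set e in edges G | o \in e] =1 weight H p.
  move=> e; rewrite /clear /weight !inE disjoint_sym disjoints1.
  by case: (e \in edges G); case: (o \in e).
rewrite (eq_expectl _ clearE).
have [-> | /set0Pn[e ew1]] := eqVneq w1 set0.
  (* With no open edge at [o], its cluster is [[set o]] and misses [b], so the conditional
     expectation is P(a <-> b) - P(a <-> b) in [H]. *)
  rewrite (@le_trans _ _ (expect (weight H p)
    (fun w => (connected_by w a b)%:R - 1 * Pr_conn H p a b))) //; last first.
    by rewrite expectB (expectMr _ (fun=> 1)) expect1 mul1r -Pr_expect subrr.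
  apply: le_expect => // w wH; rewrite set0U.
  have ow x : [set o; x] \notin w.
    by apply: wH; rewrite /weight inE disjoint_sym disjoints1 set21 andbF.
  have conn y : connected_by w o y = (o == y).
    apply/connectP/eqP => [[[|x s] /=] | ->]; last by exists [::].
      by move=> _ ->.
    by rewrite (negPf (ow x)).
  have -> : cluster w o == [set o].
    by apply/eqP/setP => y; rewrite !inE conn eq_sym.
  by rewrite conn (negPf hob) subr0.
have w1star f : f \in w1 -> exists2 y, f = [set o; y] & y \in A.
  move=> /(subsetP w1D); rewrite inE => /andP[fG of_].
  have /andP[_ /cards2P[x [y [xy fE]]]] := edgesP fG.
  wlog xo : x y xy fE / x = o.
    move=> wl; have /set2P[ox | oy] : o \in [set x; y] by rewrite -fE.
      exact: (wl x y).
    by apply: (wl y x) => //; rewrite 1?eq_sym 1?setUC.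
  rewrite xo in fE; exists y => //; have := iso y; rewrite inE -fE fG /=.
  by case/pred0Pn => z /andP[/=]; rewrite fE => /set2P[-> | ->] //; rewrite (negPf oA).
have [s eE sA] := w1star e ew1.
have le_star : expect (weight H p) (fun w => (connected_by (w1 :|: w) a b)%:R) <=
               expect (weight H p) (fun w => (connected_by (w1 :|: w) o b)%:R).
  apply: (le_connect_star (s := s)) => //; rewrite -?eE //.
    by move=> f /w1star[y -> _]; exists y.
  by rewrite -!Pr_expect; apply: a_min.
rewrite -subr_le0 -expectB in le_star; apply: le_trans le_star.
(* For nonempty [w1] the cluster term is dropped, being subtracted and nonnegative. *)
by apply: le_expect => // w _; rewrite gerBl mulr_ge0 // Pr_ge0.
Qed.
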